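(* Let $\mu>0$ and let $\mathcal W$ be the smooth worm domain. There exists no defining function $\widetilde\rho$ for $\mathcal W$ that is plurisubharmonic on the entire boundary $\partial\mathcal W$.
   Context: For $\mu>0$, the smooth worm domain is $$\mathcal W=\Big\{(z_1,z_2)\in\mathbf C^2:\ \big|z_1-e^{i\log|z_2|^2}\big|^2<1-\eta(\log|z_2|^2)\Big\}$$ (so $z_2\ne 0$), where $\eta:\mathbf R\to\mathbf R$ is a fixed $C^\infty$ function satisfying: (i) $\eta\ge0$, $\eta$ is even, $\eta$ is convex; (ii) $\eta^{-1}(0)=[-\mu,\mu]$; (iii) there is $a>0$ such that $\eta(x)>1$ if $|x|>a$; (iv) $\eta'(x)\neq0$ if $\eta(x)=1$. A defining function for $\mathcal W$ is a real-valued $C^\infty$ function $r$ on a neighborhood of $\overline{\mathcal W}$ with $\mathcal W=\{r<0\}$, $\partial\mathcal W=\{r=0\}$ and $\nabla r\neq0$ on $\partial\mathcal W$. It is plurisubharmonic on the boundary if at each point $z\in\partial\mathcal W$ its complex Hessian is positive semi-definite on all of $\mathbf C^2$, i.e. $\sum_{j,k}\frac{\partial^2 r}{\partial z_j\partial\bar z_k}(z)v_j\bar v_k\ge0$ for all $v\in\mathbf C^2$. *)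

(* Defs.v *)
From HB Require Import structures.
From mathcomp Require Import all_boot all_order all_algebra.
From mathcomp Require Import complex.
From mathcomp Require Import all_classical all_reals all_analysis.

Set Implicit Arguments.
Unset Strict Implicit.
Unset Printing Implicit Defensive.

Import Order.TTheory GRing.Theory Num.Theory.
Import numFieldNormedType.Exports.

Local Open Scope classical_set_scope.
Local Open Scope ring_scope.

(* C^2 is identified with R^2 x R^2 through z_j = x_j + i y_j, so that it
   carries the library's structure of a normed module over R (hence its
   topology and real directional derivatives 'D_v).  The index j ranges over
   'I_2: z_1 and z_2 are [zcoord p 0] and [zcoord p 1]. *)
Notation C2 R := ('rV[R]_2 * 'rV[R]_2)%type.

Section Smooth.
Variables (R : realType) (V : normedModType R).

Definition iter_derive (s : seq V) (f : V -> R) : V -> R :=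
  foldr (fun v (g : V -> R) p => 'D_v g p) f s.

(* C^infinity on an open set U of a finite-dimensional V: all iterated
   directional derivatives exist and are continuous at every point of U. *)
Definition smooth_on (U : set V) (f : V -> R) : Prop :=
  forall (s : seq V) (p : V), U p ->
    {for p, continuous (iter_derive s f)} /\
    forall v : V, derivable (iter_derive s f) p v.

End Smooth.

Definition boundary (T : topologicalType) (A : set T) : set T :=
  closure A `\` interior A.

Section ComplexPlane2.
Variable R : realType.

Definition zcoord (p : C2 R) (j : 'I_2) : R[i] := Complex (p.1 0 j) (p.2 0 j).

Definition ex (j : 'I_2) : C2 R := (delta_mx 0 j, 0).
Definition ey (j : 'I_2) : C2 R := (0, delta_mx 0 j).

Definition gradient (r : C2 R -> R) (p : C2 R) : C2 R :=
  (\row_j 'D_(ex j) r p, \row_j 'D_(ey j) r p).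

Definition cderive (f : C2 R -> R[i]) (v p : C2 R) : R[i] :=
  Complex ('D_v (fun q => complex.Re (f q)) p)
          ('D_v (fun q => complex.Im (f q)) p).

(* The Wirtinger operators d/dz_j and d/d(conj z_j). *)
Definition dz (j : 'I_2) (f : C2 R -> R[i]) (p : C2 R) : R[i] :=
  2^-1 * (cderive f (ex j) p - Complex 0 1 * cderive f (ey j) p).
Definition dzbar (j : 'I_2) (f : C2 R -> R[i]) (p : C2 R) : R[i] :=
  2^-1 * (cderive f (ex j) p + Complex 0 1 * cderive f (ey j) p).

Definition complex_hessian (r : C2 R -> R) (p : C2 R) : 'M[R[i]]_2 :=
  \matrix_(j, k) dz j (dzbar k (fun q => Complex (r q) 0)) p.

(* In the order of R[i], [0 <= w] means that w is real and nonnegative. *)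
Definition hermitian_psd (H : 'M[R[i]]_2) : Prop :=
  forall v : 'rV[R[i]]_2,
    0 <= \sum_(j < 2) \sum_(k < 2) H j k * v 0 j * conjc (v 0 k).

Definition psh_on_boundary (W : set (C2 R)) (r : C2 R -> R) : Prop :=
  forall p, boundary W p -> hermitian_psd (complex_hessian r p).

(* The domain of r is the open neighborhood U of the closure of W; the values
   of the total function r outside U are irrelevant. *)
Definition defining_function (W U : set (C2 R)) (r : C2 R -> R) : Prop :=
  [/\ open U /\ closure W `<=` U,
      smooth_on U r,
      W = [set p | U p /\ r p < 0],
      boundary W = [set p | U p /\ r p = 0] &
      forall p, boundary W p -> gradient r p != 0].

End ComplexPlane2.

Section Worm.
Variable R : realType.

Definition worm_profile (mu : R) (eta : R -> R) : Prop :=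
  [/\ forall n x, derivable (derive1n n eta) x 1,
      [/\ forall x, 0 <= eta x,
          forall x, eta (- x) = eta x &
          convex_function (setT : set R^o) eta],
      eta @^-1` [set 0] = [set` `[- mu, mu]],
      exists2 a : R, 0 < a & forall x, a < `|x| -> 1 < eta x &
      forall x, eta x = 1 -> derive1 eta x != 0].

Definition expi (t : R) : R[i] := Complex (cos t) (sin t).

(* [Normc.normc] is the modulus R[i] -> R.  The condition z_2 != 0 is explicit
   because the library's [ln] is total, with junk value at 0. *)
Definition worm (eta : R -> R) : set (C2 R) :=
  [set p | zcoord p 1 != 0 /\
    let t := ln (Normc.normc (zcoord p 1) ^+ 2) in
    Normc.normc (zcoord p 0 - expi t) ^+ 2 < 1 - eta t].

End Worm.

(* Main.v *)
(* The boundary contains the annulus z_1 = 0, |log|z_2|^2| <= mu, on which rho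
   vanishes; hence rho_{2 2bar} = 0 there, and positive semi-definiteness of
   the complex Hessian forces rho_{1 2bar} = 0, i.e. d rho/d z_1 is holomorphic
   in z_2 on the annulus.  Geometrically the z_1-gradient of rho at (0, z_2) is
   -h e^{is} with s = log|z_2|^2 and h != 0.  On the circle |z_2| = 1, the
   Cauchy-Riemann equations then turn into dh/dtheta = 2 h, which no nowhere
   vanishing 2 pi-periodic function satisfies (Rolle). *)
Require Import Defs.
From mathcomp Require Import all_boot all_order all_algebra.
From mathcomp Require Import complex.
From mathcomp Require Import all_classical all_reals all_analysis.
From mathcomp Require Import ring lra.

Import Order.TTheory GRing.Theory Num.Theory.
Import numFieldNormedType.Exports.

Local Open Scope classical_set_scope.
Local Open Scope ring_scope.

Set Implicit Arguments.
Unset Strict Implicit.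

(** * Chain rule along curves, from directional derivatives only *)

Section CurveDerivative.
Context {R : realType} {V : normedModType R}.
Implicit Types (f : V -> R) (x y : R -> R) (o q v w : V).

Lemma is_derive_cvg1 (g : R -> R) (t d : R) :
  (fun h => h^-1 * (g (h + t) - g t)) @ 0^' --> d -> is_derive t 1 g d.
Proof.
move=> gd.
have E : (fun h => h^-1 *: ((g \o shift t) (h *: (1 : R^o)) - g t)) =
         (fun h => h^-1 * (g (h + t) - g t)).
  by apply/funext => h; rewrite /= [h *: 1]mulr1.
apply: DeriveDef; first by rewrite /derivable E; apply/cvg_ex; exists d.
by rewrite /derive E; apply: cvg_lim.
Qed.

Lemma is_derive_quotient_cvg (g : R -> R) (t d : R) :
  is_derive t 1 g d -> (fun h => h^-1 * (g (h + t) - g t)) @ 0^' --> d.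
Proof.
have E : (fun h => h^-1 *: ((g \o shift t) (h *: (1 : R^o)) - g t)) =
         (fun h => h^-1 * (g (h + t) - g t)).
  by apply/funext => h; rewrite /= [h *: 1]mulr1.
by move=> [+ <-]; rewrite /derivable /derive E.
Qed.

(** Slicing [f] along [v] gives a function of one real variable, so the one-variable chain rule
    applies and no total differentiability of [f] is required. *)
Lemma is_derive_line f q v x t dx :
  derivable f (q + x t *: v) v -> is_derive t 1 x dx ->
  is_derive t 1 (fun s => f (q + x s *: v)) (dx * 'D_v f (q + x t *: v)).
Proof.
move=> fd xd; rewrite mulrC.
apply: (is_derive1_comp (f := fun u => f (q + u *: v))).
have E : (fun h : R => h^-1 * (f (q + (h + x t) *: v) - f (q + x t *: v))) =
  (fun h => h^-1 *: ((f \o shift (q + x t *: v)) (h *: v) - f (q + x t *: v))).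
  by apply/funext => h /=; rewrite scalerDl addrCA.
by apply: is_derive_cvg1; rewrite E; exact: fd.
Qed.

(* The increment along [v] is handled by the mean value theorem, the one along
   [w] at a fixed base point: continuity of ['D_v f] alone suffices. *)
Lemma is_derive_plane_curve f o v w x y t dx dy :
  (\forall p \near o + x t *: v + y t *: w, derivable f p v) ->
  {for o + x t *: v + y t *: w, continuous ('D_v f)} ->
  derivable f (o + x t *: v + y t *: w) w ->
  is_derive t 1 x dx -> is_derive t 1 y dy ->
  is_derive t 1 (fun s => f (o + x s *: v + y s *: w))
    (dx * 'D_v f (o + x t *: v + y t *: w) +
     dy * 'D_w f (o + x t *: v + y t *: w)).
Proof.
set p0 := (X in {for X, continuous _}) => fv cfv fw xd yd.
set g2 := fun s => f (o + x t *: v + y s *: w).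
set g1 := fun s => f (o + x s *: v + y s *: w) - g2 s.
have -> : (fun s => f (o + x s *: v + y s *: w)) = g1 + g2.
  by apply/funext => s; rewrite /g1 fctE subrK.
apply: is_deriveD; last exact: is_derive_line.
have xc : {for t, continuous x}.
  by apply/differentiable_continuous/derivable1_diffP; case: xd.
have yc : {for t, continuous y}.
  by apply/differentiable_continuous/derivable1_diffP; case: yd.
(* For fixed [s], [seg s] runs in direction [v] and joins the two points compared by [g1 s]; [B s]
   bounds the distance from [p0] to every point of this segment. *)
pose seg (s u : R) := o + (x t + u * (x s - x t)) *: v + y s *: w.
pose B s := `|x s - x t| * `|v| + `|y s - y t| * `|w|.
have B0 : B s @[s --> t] --> (0 : R).
  have E : 0 = `|x t - x t| * `|v| + `|y t - y t| * `|w| :> R.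
    by rewrite !subrr !normr0 !mul0r addr0.
  rewrite [X in _ --> X]E; apply: cvgD; (apply: cvgMl; apply: cvg_norm;
    apply: cvgB; [by []|exact: cvg_cst]).
have segB (s u : R) : 0 <= u <= 1 -> `|p0 - seg s u| <= B s.
  move=> /andP[u0 u1]; rewrite -normrN.
  have -> : - (p0 - seg s u) = (u * (x s - x t)) *: v + (y s - y t) *: w.
    rewrite /p0 /seg opprB scalerDl scalerBl addrA opprD addrACA.
    by rewrite [_ + _ *: v + _]addrAC subrr add0r.
  apply: (le_trans (ler_normD _ _)); rewrite !normrZ lerD2r ler_wpM2r//.
  by rewrite ger0_norm// ler_piMl.
have segE : \forall s \near t, forall u : R, 0 <= u <= 1 -> derivable f (seg s u) v.
  move/nbhs_ballP : fv => [e /= e0 pe].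
  have : \forall s \near t, B s < e by apply: cvgr_lt B0 _ _.
  apply: filterS => s Bs u u01; apply: pe.
  by rewrite -ball_normE /=; exact: le_lt_trans (segB _ _ u01) Bs.
(* Choice turns the mean value points into a function of [s]. The mean value identity is conditional
   on derivability along the segment; where that fails, [xi s] is 0, so that [xi s] always lies in
   [0, 1]. *)
have [xi xiP] : {xi : R -> R & forall s, 0 <= xi s <= 1 /\
    ((forall u : R, 0 <= u <= 1 -> derivable f (seg s u) v) ->
      g1 s = (x s - x t) * 'D_v f (seg s (xi s)))}.
  apply: (@choice _ _ (fun s c => 0 <= c <= 1 /\
    ((forall u : R, 0 <= u <= 1 -> derivable f (seg s u) v) ->
      g1 s = (x s - x t) * 'D_v f (seg s c)))) => s.
  have [H|nH] := pselect (forall u : R, 0 <= u <= 1 -> derivable f (seg s u) v);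
    last by exists 0; split; [rewrite lexx ler01|].
  have dseg (u : R) : 0 <= u <= 1 ->
      is_derive u 1 (fun r => f (seg s r)) ((x s - x t) * 'D_v f (seg s u)).
    move=> u01; have xd' : is_derive u 1 (fun r => x t + r * (x s - x t)) (x s - x t).
      by apply: is_derive_eq; rewrite scaler0 !add0r mul1r [LHS]mulr1.
    have E r : seg s r = (o + y s *: w) + (x t + r * (x s - x t)) *: v.
      by rewrite /seg addrAC.
    under eq_fun do rewrite E.
    by rewrite E; apply: is_derive_line xd'; rewrite -E; exact: H.
  have [||c] := @MVT_segment R (fun r => f (seg s r))
      (fun u => (x s - x t) * 'D_v f (seg s u)) 0 1 ler01.
  - by move=> u; rewrite in_itv/= => /andP[u0 u1]; apply: dseg; rewrite !ltW.
  - apply: derivable_within_continuous => u; rewrite in_itv/= => u01.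
    by have [] := dseg _ u01.
  rewrite in_itv/= => c01 fE; exists c; split=> // _.
  by move: fE; rewrite /seg subr0 mulr1 mul0r mul1r addr0 [x t + _]addrC subrK.
have segc : seg s (xi s) @[s --> t] --> p0.
  apply/cvgrPdist_lt => e e0.
  have : \forall s \near t, B s < e by apply: cvgr_lt B0 _ _.
  by apply: filterS => s; apply: le_lt_trans; apply: segB; case: (xiP s).
apply: is_derive_cvg1.
have -> : g1 t = 0 by rewrite /g1 /g2 subrr.
have shc : (h + t) @[h --> 0^'] --> t.
  rewrite -[X in _ --> X]add0r; apply: cvgD; last exact: cvg_cst.
  by move=> A; exact: nbhs_dnbhs.
have Dc : 'D_v f (seg (h + t) (xi (h + t))) @[h --> 0^'] --> 'D_v f p0.
  have sc := cvg_comp _ (fun s => seg s (xi s)) shc segc.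
  exact: (cvg_comp _ ('D_v f) sc cfv).
(* Near 0 the difference quotient of [g1] is that of [x] times ['D_v f] at the mean value point,
   which tends to [p0]. *)
apply: cvg_trans (cvgM (is_derive_quotient_cvg xd) Dc).
apply: near_eq_cvg.
have segE' : \forall h \near 0^', forall u : R, 0 <= u <= 1 ->
    derivable f (seg (h + t) u) v by have := shc _ segE.
apply: filterS segE' => h hE.
by rewrite subr0 (xiP _).2// mulrA.
Qed.

End CurveDerivative.

(** * Smooth functions along curves, and relations that hold near a point *)

Section SmoothCurves.
Context {R : realType} {V : normedModType R}.
Implicit Types (U : set V) (f : V -> R).

Lemma smooth_on_derivable U f p v : smooth_on U f -> U p -> derivable f p v.
Proof. by move=> sf /(sf [::])[_]; apply. Qed.

Lemma smooth_on_derive U f v : smooth_on U f -> smooth_on U ('D_v f).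
Proof.
(* [foldr] applies the last direction of the list first, so the innermost derivative is appended at
   the end. *)
move=> sf s p Up; have := sf (rcons s v) p Up.
by rewrite /iter_derive foldr_rcons.
Qed.

Lemma is_derive_smooth_curve U f o v w (x y : R -> R) t dx dy :
  open U -> smooth_on U f -> U (o + x t *: v + y t *: w) ->
  is_derive t 1 x dx -> is_derive t 1 y dy ->
  is_derive t 1 (fun s => f (o + x s *: v + y s *: w))
    (dx * 'D_v f (o + x t *: v + y t *: w) +
     dy * 'D_w f (o + x t *: v + y t *: w)).
Proof.
move=> oU sf Up; apply: is_derive_plane_curve.
- have := open_nbhs_nbhs (conj oU Up).
  by apply: filterS => p; exact: smooth_on_derivable.
- by have [] := sf [:: v] _ Up.
- exact: smooth_on_derivable Up.
Qed.

Lemma near_is_derive_eq0 (g : R -> R) t d :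
  (\forall s \near t, g s = 0) -> is_derive t 1 g d -> d = 0.
Proof.
move=> g0 gd.
have [_ <-] := near_eq_is_derive (g := cst 0) g0 gd.
by rewrite derive_cst.
Qed.

Lemma derive_line_near0 f q v t : derivable f (q + t *: v) v ->
  (\forall s \near t, f (q + s *: v) = 0) -> 'D_v f (q + t *: v) = 0.
Proof.
move=> fd f0; have := is_derive_line (x := id) fd (is_derive_id _ _).
by rewrite mul1r => /near_is_derive_eq0; apply.
Qed.

(** Differentiating the relation at a zero of [s] kills the terms with [da] and with the derivative
    of the cosine, and leaves [ds * a t] against [db]. *)
Lemma derive_sin_cos_proportional (a b s : R -> R) (t da db ds : R) :
  is_derive t 1 a da -> is_derive t 1 b db -> is_derive t 1 s ds -> s t = 0 ->
  (\forall u \near t, sin (s u) * a u = cos (s u) * b u) -> db = ds * a t.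
Proof.
move=> ad bd sd st0 ab.
have sind := is_derive1_comp (is_derive_sin (s t)) sd.
have cosd := is_derive1_comp (is_derive_cos (s t)) sd.
have /near_is_derive_eq0 := is_deriveB (is_deriveM sind ad) (is_deriveM cosd bd).
have ab0 : \forall u \near t, sin (s u) * a u - cos (s u) * b u = 0.
  by apply: filterS ab => u ->; rewrite subrr.
move=> /(_ ab0); rewrite /= st0 sin0 cos0 scale0r scale1r add0r oppr0 mul0r.
rewrite scaler0 addr0 mul1r => /eqP; rewrite subr_eq0 => /eqP <-.
exact: mulrC.
Qed.

End SmoothCurves.

(** * The complex Hessian and its degenerate direction *)

Section Hessian.
Context {R : realType}.

Lemma half_addCi (a b c d : R) :
  2^-1 * (Complex a b + Complex 0 1 * Complex c d) =
  Complex (2^-1 * (a - d)) (2^-1 * (b + c)).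
Proof.
have -> : 2^-1 = Complex (2^-1) 0 :> R[i].
  by rewrite -[RHS]/((2^-1)%:C)%C fmorphV rmorph_nat.
rewrite -[LHS]/(Complex (2^-1 * (a + (0 * c - 1 * d)) - 0 * (b + (0 * d + 1 * c)))
  (2^-1 * (b + (0 * d + 1 * c)) + 0 * (a + (0 * c - 1 * d)))).
by rewrite !mul0r !mul1r !add0r subr0 addr0.
Qed.

Lemma half_subCi (a b c d : R) :
  2^-1 * (Complex a b - Complex 0 1 * Complex c d) =
  Complex (2^-1 * (a + d)) (2^-1 * (b - c)).
Proof.
rewrite -mulrN -[- Complex c d]/(Complex (- c) (- d)) half_addCi.
by rewrite opprK.
Qed.

Lemma cderive_half (f g : C2 R -> R) v p :
  derivable f p v -> derivable g p v ->
  cderive (fun q => Complex (2^-1 * f q) (2^-1 * g q)) v p =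
    Complex (2^-1 * 'D_v f p) (2^-1 * 'D_v g p).
Proof.
move=> fd gd.
by rewrite /cderive; congr Complex; [exact: (deriveZ (2^-1) fd)|exact: (deriveZ (2^-1) gd)].
Qed.

Lemma complex_hessianE (r : C2 R -> R) p j k :
  derivable ('D_(ex R k) r) p (ex R j) -> derivable ('D_(ex R k) r) p (ey R j) ->
  derivable ('D_(ey R k) r) p (ex R j) -> derivable ('D_(ey R k) r) p (ey R j) ->
  complex_hessian r p j k =
    Complex (4^-1 * ('D_(ex R j) ('D_(ex R k) r) p + 'D_(ey R j) ('D_(ey R k) r) p))
            (4^-1 * ('D_(ex R j) ('D_(ey R k) r) p - 'D_(ey R j) ('D_(ex R k) r) p)).
Proof.
move=> dxx dxy dyx dyy; rewrite mxE.
have -> : dzbar k (fun q => Complex (r q) 0) =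
    (fun q => Complex (2^-1 * 'D_(ex R k) r q) (2^-1 * 'D_(ey R k) r q)).
  apply/funext => q; rewrite /dzbar /cderive half_addCi !derive_cst.
  by rewrite subr0 add0r.
rewrite /dz (cderive_half dxx dyx) (cderive_half dxy dyy).
rewrite half_subCi.
have halfD (a b : R) : 2^-1 * (2^-1 * a + 2^-1 * b) = 4^-1 * (a + b) by field.
have halfB (a b : R) : 2^-1 * (2^-1 * a - 2^-1 * b) = 4^-1 * (a - b) by field.
by congr Complex; [exact: halfD|exact: halfB].
Qed.

(** Since the [1 1] entry vanishes, the form at the vector (1, w) is real-affine in w; being bounded
    below, it must be constant. *)
Lemma hermitian_psd_offdiag (H : 'M[R[i]]_2) :
  hermitian_psd H -> H 1 1 = 0 -> H 1 0 = 0.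
Proof.
move=> psd H11.
have Q x y : 0 <= H 0 0 + H 0 1 * Complex x (- y) + H 1 0 * Complex x y.
  have := psd (\row_j if j == 0 then 1 else Complex x y).
  rewrite !big_ord_recl !big_ord0 !mxE /=.
  rewrite (_ : lift ord0 ord0 = 1) ?H11; last exact/val_inj.
  by rewrite !mul0r !addr0 oppr0 -[Complex 1 0]/(1 : R[i]) !mulr1.
case: (H 0 0) Q => h k; case: (H 0 1) => p q; case: (H 1 0) => r s Q.
have {}Q x y : k + (q * x - p * y) + (s * x + r * y) = 0 /\
               0 <= h + (p * x + q * y) + (r * x - s * y).
  have := Q x y; rewrite lecE /= => /andP[/eqP E1 E2]; split.
    by rewrite -[RHS]E1; ring.
  by apply: (le_trans E2); rewrite le_eqVlt; apply/orP; left; apply/eqP; ring.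
(* Reality of the form at w = 0, 1, i forces [H 0 1] to be the conjugate of [H 1 0]; the value at w
   = x + iy is then h + 2 (r x - s y). *)
have k0 : k = 0 by have [] := Q 0 0; lra.
have qs : q = - s by have [] := Q 1 0; lra.
have pr : p = r by have [] := Q 0 1; lra.
have h0 : 0 <= h by have [] := Q 0 0; lra.
have [D0|Dn0] := eqVneq (r ^+ 2 + s ^+ 2) 0.
  have r0 : r = 0 by nra.
  have s0 : s = 0 by nra.
  by rewrite r0 s0.
(* This is w = - (h + 1) / [H 1 0], chosen so that the form takes the negative value h - 2 (h +
   1). *)
have [_] := Q (- r * (h + 1) / (r ^+ 2 + s ^+ 2)) (s * (h + 1) / (r ^+ 2 + s ^+ 2)).
rewrite qs pr.
set X := (X in 0 <= X); have -> : X = - h - 2 by rewrite /X; field.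
move=> X0; have : h < 0 by lra.
by rewrite ltNge h0.
Qed.

(** The hypotheses are shaped to receive [complex_hessianE] at the entries [1 1] and [1 0]: the
    unprimed reals stand for second derivatives in z_2 alone, the primed ones for mixed derivatives
    in z_1 and z_2. *)
Lemma hermitian_psd_cauchy_riemann (H : 'M[R[i]]_2) (a b c d a' b' c' d' : R) :
  hermitian_psd H -> H 1 1 = Complex (4^-1 * (a + b)) (4^-1 * (c - d)) ->
  a = 0 -> b = 0 -> c = 0 -> d = 0 ->
  H 1 0 = Complex (4^-1 * (a' + b')) (4^-1 * (c' - d')) -> a' = - b' /\ d' = c'.
Proof.
move=> psd + a0 b0 c0 d0; rewrite a0 b0 c0 d0 addr0 subr0 mulr0.
move=> /(hermitian_psd_offdiag psd) -> [] /esym/eqP + /esym/eqP.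
rewrite !mulf_eq0 !invr_eq0 !pnatr_eq0 /= addr_eq0 subr_eq0.
by move=> /eqP -> /eqP ->.
Qed.

End Hessian.

Lemma row2_eq0 (R : nmodType) (f : 'I_2 -> R) :
  f 0 = 0 -> f 1 = 0 -> \row_j f j = 0.
Proof.
move=> f0 f1; apply/rowP => -[[|[|//]] i]; rewrite !mxE.
- by rewrite -f0; congr f; exact/val_inj.
- by rewrite -f1; congr f; exact/val_inj.
Qed.

(** * Circles contained in the boundary of the worm *)

Section WormBoundary.
Context {R : realType}.
Implicit Types (a b c d u : R) (mu : R) (eta : R -> R).

(* The point (a + i b, c + i d) of C^2. *)
Definition c2pt a b c d : C2 R :=
  c *: ex R 1 + d *: ey R 1 + a *: ex R 0 + b *: ey R 0.

Lemma zcoord0_c2pt a b c d : zcoord (c2pt a b c d) 0 = Complex a b.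
Proof.
rewrite /zcoord /= !mxE /=.
by rewrite !mulr0 !mulr1 !addr0 !add0r.
Qed.

Lemma zcoord1_c2pt a b c d : zcoord (c2pt a b c d) 1 = Complex c d.
Proof.
rewrite /zcoord /= !mxE /=.
by rewrite !mulr0 !mulr1 !addr0 !add0r.
Qed.

Lemma sqr_normc a b : Normc.normc (Complex a b) ^+ 2 = a ^+ 2 + b ^+ 2.
Proof. by rewrite /= sqr_sqrtr// addr_ge0// sqr_ge0. Qed.

Lemma worm_c2pt eta a b c d : c ^+ 2 + d ^+ 2 != 0 ->
  let t := ln (c ^+ 2 + d ^+ 2) in
  worm eta (c2pt a b c d) <->
    (a - cos t) ^+ 2 + (b - sin t) ^+ 2 < 1 - eta t.
Proof.
move=> cd0 t.
rewrite /worm /mkset zcoord0_c2pt zcoord1_c2pt sqr_normc -/t.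
rewrite -[Complex a b - _]/(Complex (a - cos t) (b - sin t)) sqr_normc.
(* The explicit condition that z_2 is nonzero follows from [cd0]. *)
split=> [[]//|?]; split=> //; apply: contraNneq cd0 => -[-> ->].
by rewrite expr0n addr0.
Qed.

(** Where [eta] vanishes, the slice of the worm over z_2 is an open unit disc centred at e^{it}.
    Points of its bounding circle fail the strict inequality, yet are limits of points of the disc
    along a radius. *)
Lemma boundary_worm mu eta a b c d : worm_profile mu eta ->
  c ^+ 2 + d ^+ 2 != 0 -> `|ln (c ^+ 2 + d ^+ 2)| <= mu ->
  (a - cos (ln (c ^+ 2 + d ^+ 2))) ^+ 2 +
    (b - sin (ln (c ^+ 2 + d ^+ 2))) ^+ 2 = 1 ->
  boundary (worm eta) (c2pt a b c d).
Proof.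
move=> [_ _ eta0 _ _] cd0.
have /= wE a' b' := worm_c2pt eta a' b' cd0.
move: wE; set t := ln _ => wE tmu abt.
have etat : eta t = 0.
  have : (eta @^-1` [set 0]) t by rewrite eta0 /= in_itv/= -ler_norml.
  by [].
split; last first.
  move/interior_subset/wE; rewrite etat abt; lra.
(* The radius from the given point at u = 0 to the centre at u = 1; the distance to the centre is
   multiplied by 1 - u. *)
pose g u := c2pt (a + u * (cos t - a)) (b + u * (sin t - b)) c d.
have gc : g u @[u --> 0^'+] --> c2pt a b c d.
  apply: cvg_at_right_filter.
  have -> : c2pt a b c d = g 0 by rewrite /g !mul0r !addr0.
  rewrite /g /c2pt.
  by apply: cvgD; [apply: cvgD; [exact: cvg_cst|]|];
    apply: cvgZl; apply: cvgD; [exact: cvg_cst| |exact: cvg_cst|];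
    apply: cvgMl.
move=> B /gc gB.
have [u [/= gBu u0 u1]] : exists u, [/\ B (g u), 0 < u & u < 1].
  near (0 : R)^'+ => u; exists u; split.
  - by near: u.
  - by near: u; exact: nbhs_right_gt.
  - by near: u; exact: nbhs_right_lt.
exists (g u); split=> //; apply/wE; rewrite etat subr0.
have -> : (a + u * (cos t - a) - cos t) ^+ 2 + (b + u * (sin t - b) - sin t) ^+ 2
  = (1 - u) ^+ 2 * ((a - cos t) ^+ 2 + (b - sin t) ^+ 2) by ring.
by rewrite abt mulr1; nra.
Unshelve. all: by end_near. Qed.

End WormBoundary.

(** * Derivatives of the defining function on the annulus z_1 = 0 *)

Section WormAnnulus.
Context {R : realType} (mu : R) (eta : R -> R) (U : set (C2 R))
  (rho : C2 R -> R) (mu_gt0 : 0 < mu) (Heta : worm_profile mu eta)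
  (rhoP : defining_function (worm eta) U rho)
  (rho_psh : psh_on_boundary (worm eta) rho).

Let Dx1 := 'D_(ex R 0) rho.
Let Dy1 := 'D_(ey R 0) rho.
Let Dx2 := 'D_(ex R 1) rho.
Let Dy2 := 'D_(ey R 1) rho.

(** The strict inequality makes the annulus open in the z_2-plane, so that identities on it can be
    differentiated. The origin is excluded by hand because [ln] is total. *)
Definition in_annulus (c d : R) :=
  c ^+ 2 + d ^+ 2 != 0 /\ `|ln (c ^+ 2 + d ^+ 2)| < mu.

Lemma boundary_annulus c d : in_annulus c d ->
  boundary (worm eta) (c2pt 0 0 c d).
Proof.
move=> [cd0 lcd]; apply: (boundary_worm Heta) => //; first exact: ltW.
by rewrite !sub0r !sqrrN cos2Dsin2.
Qed.

Lemma defining_eq0 p : boundary (worm eta) p -> U p /\ rho p = 0.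
Proof. by case: rhoP => _ _ _ -> _. Qed.

Lemma rho_smooth : smooth_on U rho. Proof. by case: rhoP. Qed.
Lemma open_U : open U. Proof. by case: rhoP => -[]. Qed.

Lemma in_annulus_near (x y : R -> R) t : {for t, continuous x} ->
  {for t, continuous y} -> in_annulus (x t) (y t) ->
  \forall s \near t, in_annulus (x s) (y s).
Proof.
move=> xc yc [n0 lmu].
have nc : x s ^+ 2 + y s ^+ 2 @[s --> t] --> x t ^+ 2 + y t ^+ 2.
  by apply: cvgD; apply: cvgM.
have n_gt0 : 0 < x t ^+ 2 + y t ^+ 2.
  by rewrite lt_neqAle eq_sym n0 addr_ge0// sqr_ge0.
have lc : `|ln (x s ^+ 2 + y s ^+ 2)| @[s --> t] --> `|ln (x t ^+ 2 + y t ^+ 2)|.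
  by apply: cvg_norm; apply: (cvg_comp _ _ nc); exact: continuous_ln.
near=> s; split.
- rewrite gt_eqF//; near: s; exact: cvgr_gt nc _ n_gt0.
- near: s; exact: cvgr_lt lc _ lmu.
Unshelve. all: by end_near. Qed.

Lemma c2pt_x2line c d :
  c2pt 0 0 c d = d *: ey R 1 + c *: ex R 1.
Proof. by rewrite /c2pt !scale0r !addr0 addrC. Qed.

Lemma c2pt_y2line c d :
  c2pt 0 0 c d = c *: ex R 1 + d *: ey R 1.
Proof. by rewrite /c2pt !scale0r !addr0. Qed.

(** By openness, [f] vanishes on short segments through the point in both real z_2-directions. Used
    first for [rho], then for its first derivatives in z_2. *)
Lemma annulus_derive_eq0 (f : C2 R -> R) : smooth_on U f ->
  (forall c d, in_annulus c d -> f (c2pt 0 0 c d) = 0) ->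
  forall c d, in_annulus c d ->
  'D_(ex R 1) f (c2pt 0 0 c d) = 0 /\ 'D_(ey R 1) f (c2pt 0 0 c d) = 0.
Proof.
move=> sf f0 c d cd.
have [Up _] := defining_eq0 (boundary_annulus cd); split.
- rewrite c2pt_x2line; apply: derive_line_near0.
    by apply: smooth_on_derivable sf _; rewrite -c2pt_x2line.
  have : \forall s \near c, in_annulus s d.
    by apply: (@in_annulus_near id (cst d)) => //; exact: cvg_cst.
  by apply: filterS => s sd; rewrite -c2pt_x2line f0.
- rewrite c2pt_y2line; apply: derive_line_near0.
    by apply: smooth_on_derivable sf _; rewrite -c2pt_y2line.
  have : \forall s \near d, in_annulus c s.
    by apply: (@in_annulus_near (cst c) id) => //; exact: cvg_cst.
  by apply: filterS => s sd; rewrite -c2pt_y2line f0.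
Qed.

Lemma annulus_rho2_eq0 c d : in_annulus c d ->
  Dx2 (c2pt 0 0 c d) = 0 /\ Dy2 (c2pt 0 0 c d) = 0.
Proof.
apply: annulus_derive_eq0; first exact: rho_smooth.
by move=> {}c {}d /boundary_annulus/defining_eq0[].
Qed.

(** These are the Cauchy-Riemann equations in z_2 for [Dx1] - i [Dy1], which is twice the
    z_1-derivative of [rho]. All second derivatives of [rho] in z_2 vanish here, so the Hessian is
    degenerate in that direction. *)
Lemma annulus_cauchy_riemann c d : in_annulus c d ->
  'D_(ex R 1) Dx1 (c2pt 0 0 c d) = - 'D_(ey R 1) Dy1 (c2pt 0 0 c d) /\
  'D_(ey R 1) Dx1 (c2pt 0 0 c d) = 'D_(ex R 1) Dy1 (c2pt 0 0 c d).
Proof.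
move=> cd; have bp := boundary_annulus cd.
have [Up _] := defining_eq0 bp.
have dd u v : derivable ('D_u rho) (c2pt 0 0 c d) v.
  exact: smooth_on_derivable (smooth_on_derive _ rho_smooth) Up.
set p := c2pt 0 0 c d in bp Up dd *.
have [Dxx2 Dyx2] : 'D_(ex R 1) Dx2 p = 0 /\ 'D_(ey R 1) Dx2 p = 0.
  apply: annulus_derive_eq0 cd; first exact: smooth_on_derive _ rho_smooth.
  by move=> ? ? /annulus_rho2_eq0[].
have [Dxy2 Dyy2] : 'D_(ex R 1) Dy2 p = 0 /\ 'D_(ey R 1) Dy2 p = 0.
  apply: annulus_derive_eq0 cd; first exact: smooth_on_derive _ rho_smooth.
  by move=> ? ? /annulus_rho2_eq0[].
by apply: (hermitian_psd_cauchy_riemann (rho_psh bp)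
  (complex_hessianE (dd _ _) (dd _ _) (dd _ _) (dd _ _))
  Dxx2 Dyy2 Dxy2 Dyx2
  (complex_hessianE (dd _ _) (dd _ _) (dd _ _) (dd _ _))).
Qed.

(* Over each point of the annulus, the boundary contains a circle in the
   z_1-plane through 0, whose tangent at 0 is killed by [d rho]. *)
Lemma annulus_gradient_direction c d : in_annulus c d ->
  let s := ln (c ^+ 2 + d ^+ 2) in
  sin s * Dx1 (c2pt 0 0 c d) = cos s * Dy1 (c2pt 0 0 c d).
Proof.
move=> cd s; have [Up _] := defining_eq0 (boundary_annulus cd).
pose o := c *: ex R 1 + d *: ey R 1.
(* The curve e^{is} - e^{it} traces the unit circle centred at e^{is} and passes through 0 at t =
   s. *)
pose x t := cos s - cos t; pose y t := sin s - sin t.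
have xd : is_derive s 1 x (sin s).
  by apply: is_derive_eq; rewrite add0r mul1r opprK.
have yd : is_derive s 1 y (- cos s).
  by apply: is_derive_eq; rewrite add0r mul1r.
have x0 : x s = 0 by rewrite /x subrr.
have y0 : y s = 0 by rewrite /y subrr.
have Us : U (o + x s *: ex R 0 + y s *: ey R 0) by rewrite x0 y0.
have := is_derive_smooth_curve open_U rho_smooth Us xd yd.
move=> /near_is_derive_eq0; rewrite x0 y0 => E.
have : sin s * Dx1 (c2pt 0 0 c d) + - cos s * Dy1 (c2pt 0 0 c d) = 0.
  apply: E; apply: filterE => t.
  have [|_ rho0] := @defining_eq0 (c2pt (x t) (y t) c d); last exact: rho0.
  apply: (boundary_worm Heta) cd.1 (ltW cd.2) _.
  by rewrite -/s /x /y [cos s - _ - _]addrAC [sin s - _ - _]addrAC !subrr !sub0r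
    !sqrrN cos2Dsin2.
by rewrite mulNr => /eqP; rewrite subr_eq0 => /eqP.
Qed.

Lemma circle_in_annulus th : in_annulus (cos th) (sin th).
Proof. by rewrite /in_annulus cos2Dsin2 ln1 normr0 oner_eq0. Qed.

(** Over |z_2| = 1 the disc is centred at 1, so its boundary circle has a vertical tangent at 0. *)
Lemma circle_Dy1_eq0 th : Dy1 (c2pt 0 0 (cos th) (sin th)) = 0.
Proof.
have := annulus_gradient_direction (circle_in_annulus th).
by rewrite cos2Dsin2 ln1 /= sin0 cos0 mul0r mul1r.
Qed.

(** The three other components of the gradient vanish at this point, while the gradient itself does
    not. *)
Lemma circle_Dx1_neq0 th : Dx1 (c2pt 0 0 (cos th) (sin th)) != 0.
Proof.
have cth := circle_in_annulus th.
case: rhoP => _ _ _ _ /(_ _ (boundary_annulus cth)).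
apply: contraNneq => x10; have [x20 y20] := annulus_rho2_eq0 cth.
have y10 := circle_Dy1_eq0 th.
have px0 := @row2_eq0 _ (fun j => 'D_(ex R j) rho _) x10 x20.
have py0 := @row2_eq0 _ (fun j => 'D_(ey R j) rho _) y10 y20.
exact/eqP/(congr2 pair px0 py0).
Qed.

(** The left side is the radial derivative of [Dy1]. It comes from differentiating the relation of
    [annulus_gradient_direction] along the ray z_2 = u e^{i th} at u = 1; the factor 2 is the
    derivative of ln(u^2) there. *)
Lemma circle_radial_derivative th :
  let p := c2pt 0 0 (cos th) (sin th) in
  cos th * 'D_(ex R 1) Dy1 p + sin th * 'D_(ey R 1) Dy1 p = 2 * Dx1 p.
Proof.
move=> p; have cth := circle_in_annulus th.
have [Up _] := defining_eq0 (boundary_annulus cth).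
pose x u : R := u * cos th; pose y u : R := u * sin th.
have x1 : x 1 = cos th by rewrite /x mul1r.
have y1 : y 1 = sin th by rewrite /y mul1r.
have lin k : is_derive (1 : R) 1 (fun u => u * k) k.
  have := is_deriveZ k (is_derive_id (1 : R) 1).
  rewrite (_ : k \*: id = fun u => u * k); last by apply/funext => u; exact: mulrC.
  by rewrite [k *: 1]mulr1.
have xd : is_derive (1 : R) 1 x (cos th) by exact: lin.
have yd : is_derive (1 : R) 1 y (sin th) by exact: lin.
pose s u : R := ln (u ^+ 2).
have sd : is_derive (1 : R) 1 s 2.
  have ln1d : is_derive ((id ^+ 2) (1 : R)) 1 (@ln R) ((id ^+ 2) (1 : R))^-1.
    by apply: is_derive1_ln; rewrite exprfctE expr1n.
  have := is_derive1_comp ln1d (is_deriveX 2 (is_derive_id (1 : R) 1)).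
  rewrite exprfctE !expr1n invr1 mul1r mulr1 [_ *: _]mulr1.
  by congr is_derive.
have s1 : s 1 = 0 by rewrite /s expr1n ln1.
have sE u : ln (x u ^+ 2 + y u ^+ 2) = s u.
  by rewrite /x /y !exprMn -mulrDr cos2Dsin2 mulr1.
have pE : 0 + x 1 *: ex R 1 + y 1 *: ey R 1 = p.
  by rewrite add0r x1 y1 -c2pt_y2line.
have Up' : U (0 + x 1 *: ex R 1 + y 1 *: ey R 1) by rewrite pE.
have Ad := is_derive_smooth_curve open_U
  (smooth_on_derive (ex R 0) rho_smooth) Up' xd yd.
have Bd := is_derive_smooth_curve open_U
  (smooth_on_derive (ey R 0) rho_smooth) Up' xd yd.
have {}cth : in_annulus (x 1) (y 1) by rewrite x1 y1; exact: circle_in_annulus.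
have xc : {for (1 : R), continuous x}.
  by apply/differentiable_continuous/derivable1_diffP; case: xd.
have yc : {for (1 : R), continuous y}.
  by apply/differentiable_continuous/derivable1_diffP; case: yd.
have near0 : \forall u \near (1 : R),
    sin (s u) * Dx1 (0 + x u *: ex R 1 + y u *: ey R 1) =
    cos (s u) * Dy1 (0 + x u *: ex R 1 + y u *: ey R 1).
  apply: filterS (in_annulus_near xc yc cth) => u /annulus_gradient_direction.
  by rewrite /= sE add0r -c2pt_y2line.
have := derive_sin_cos_proportional Ad Bd sd s1 near0.
by rewrite pE.
Qed.

(** The Cauchy-Riemann equations identify the angular derivative of [Dx1] on the unit circle with
    the radial derivative of [Dy1], already known. *)
Lemma circle_Dx1_derivative th :
  is_derive (th : R) 1 (fun t => Dx1 (c2pt 0 0 (cos t) (sin t)))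
    (2 * Dx1 (c2pt 0 0 (cos th) (sin th))).
Proof.
have cth := circle_in_annulus th.
have [Up _] := defining_eq0 (boundary_annulus cth).
have E t : c2pt 0 0 (cos t) (sin t) = 0 + cos t *: ex R 1 + sin t *: ey R 1.
  by rewrite add0r c2pt_y2line.
have -> : (fun t => Dx1 (c2pt 0 0 (cos t) (sin t))) =
    (fun t => Dx1 (0 + cos t *: ex R 1 + sin t *: ey R 1)).
  by apply/funext => t; rewrite E.
rewrite -circle_radial_derivative.
have [CR1 CR2] := annulus_cauchy_riemann cth.
rewrite -CR2 -[X in sin th * X]opprK -CR1 mulrN addrC -mulNr.
rewrite E in Up *.
exact: is_derive_smooth_curve open_U (smooth_on_derive _ rho_smooth) Up
  (is_derive_cos th) (is_derive_sin th).
Qed.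

Lemma no_psh_defining_function : False.
Proof.
pose phi t := Dx1 (c2pt 0 0 (cos t) (sin t)).
(* At the critical point [c], the equation phi' = 2 phi makes [phi] itself vanish, against
   [circle_Dx1_neq0]. *)
have [| | | |c _ [_ phi0]] := @Rolle R phi 0 (pi *+ 2).
- by rewrite mulrn_wgt0// pi_gt0.
- by move=> t _; have [] := circle_Dx1_derivative t.
- apply: derivable_within_continuous => t _.
  by have [] := circle_Dx1_derivative t.
- by rewrite /phi cos0 sin0 cos2pi sin2pi.
have [_] := circle_Dx1_derivative c.
rewrite phi0 => /esym/eqP; rewrite mulf_eq0 pnatr_eq0 /=.
exact/negP/circle_Dx1_neq0.
Qed.

End WormAnnulus.

Theorem proposition2p2 (R : realType) (mu : R) (eta : R -> R)
    (mu_gt0 : 0 < mu) (Heta : worm_profile mu eta) :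
  ~ exists (U : set (C2 R)) (rho : C2 R -> R),
      defining_function (worm eta) U rho /\ psh_on_boundary (worm eta) rho.
Proof.
move=> [U [rho [rhoP rho_psh]]].
exact: no_psh_defining_function mu_gt0 Heta rhoP rho_psh.
Qed.
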